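(* Let $d\ge 2$ and let $\widehat F_d$ be the free profinite group of rank $d$, with normalised Haar measure $\mu$. Let $\mathcal E$ be the family of formulae $\eta_w(x)$ given by $\exists\boldsymbol y:\ w(x,\boldsymbol y)=1$, where $w$ runs over the set of $d$-zero-one words. Then $\mathrm{Spec}_\mu(\mathcal E,\widehat F_d)=\{0,1\}$.
   Context: A word in $k+1$ variables is an element $w(x,\boldsymbol y)$ of the free group on $x,y_1,\dots,y_k$, where $\boldsymbol y=(y_1,\dots,y_k)$; write $\#\mathrm{var}(w)=k+1$ for its number of variables. Let $-n(w)$ be the sum of the exponents of $x$ in $w$, let $n_i$ be the sum of the exponents of $y_i$ in $w$, and let $l(w)=\gcd(n_1,\dots,n_k)$, with $l(w)=0$ if all $n_i$ are zero. Given a prime $p$ and an integer $d\ge 2$, the word $w$ is a $(p,d)$-zero-one word if it satisfies one of the following: (1) $n(w)=0$; (2) $n(w)\ne 0$ and $l(w)\mid n(w)$; (3) $n(w)\neq 0$ and $l(w)=0$; (4) $n(w)\ne 0$, $l(w)\neq 0$, $l(w)\nmid n(w)$, $p\mid\gcd(1-n(w),l(w))$ and $\#\mathrm{var}(w)\le d-1$. The word $w$ is a $d$-zero-one word if it is a $(p,d)$-zero-one word for some prime $p$. For a formula $\varphi(x)$ in the language of groups with one free variable and a group $G$, $G_\varphi=\{g\in G\mid\varphi(g)\text{ is true in }G\}$. For a family $\mathcal F$ of such formulae and a profinite group $G$ with normalised Haar measure $\mu$ (so $\mu(G)=1$), $\mathrm{Spec}_\mu(\mathcal F,G)=\{\mu(G_\varphi)\mid\varphi\in\mathcal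 F\}$. *)

(* Defs.v *)
From HB Require Import structures.
From mathcomp Require Import all_boot all_order all_algebra.
From mathcomp Require Import all_classical all_reals all_analysis.

Set Implicit Arguments.
Unset Strict Implicit.
Unset Printing Implicit Defensive.

Import Order.TTheory GRing.Theory Num.Theory.

Local Open Scope classical_set_scope.

HB.mixin Record isTopologicalGroup G & Group G & Topological G := {
  mulg_continuous : continuous (fun xy : G * G => (xy.1 * xy.2)%g) ;
  invg_continuous : continuous (fun x : G => (x^-1)%g)
}.

#[short(type="topologicalGroupType")]
HB.structure Definition TopologicalGroup :=
  {G of Group G & Topological G & isTopologicalGroup G}.

HB.mixin Record isProfiniteGroup G & TopologicalGroup G := {
  profinite_compact : compact [set: G] ;
  profinite_hausdorff : hausdorff_space G ;
  profinite_totally_disconnected : totally_disconnected [set: G]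
}.

#[short(type="profiniteGroupType")]
HB.structure Definition ProfiniteGroup :=
  {G of TopologicalGroup G & isProfiniteGroup G}.

Definition continuous_morphism (G H : topologicalGroupType) (phi : G -> H) :=
  {morph phi : x y / (x * y)%g} /\ continuous phi.

(* The universal property determines the free profinite group of rank [d] up to
   isomorphism of topological groups. *)
Definition free_profinite (d : nat) (G : profiniteGroupType) :=
  exists x : 'I_d -> G,
    forall (H : profiniteGroupType) (f : 'I_d -> H),
      exists! phi : G -> H,
        continuous_morphism phi /\ forall i, phi (x i) = f i.

(* Measurable types are pointed, groups are not declared to be: this alias
   points a group at its neutral element. *)
Definition pointed_group (G : groupType) : Type := G.
HB.instance Definition _ (G : groupType) := Choice.on (pointed_group G).
HB.instance Definition _ (G : groupType) :=
  isPointed.Build (pointed_group G) (1%g : G).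

Definition borel (G : topologicalGroupType) :=
  @g_sigma_algebraType (pointed_group G) (@open G).

Section Haar.
Variables (R : realType) (G : topologicalGroupType).
Variable mu : probability (borel G) R.

Definition left_invariant :=
  forall (g : G) (A : set (borel G)), measurable A ->
    mu [set (g * a)%g | a in (A : set G)] = mu A.

Definition outer_regular :=
  forall A : set (borel G), measurable A ->
    mu A = ereal_inf [set mu U | U in [set U : set G | open U /\ A `<=` U]].

Definition inner_regular :=
  forall U : set G, open U ->
    mu U = ereal_sup [set mu K | K in [set K : set G | compact K /\ K `<=` U]].

Definition normalised_haar :=
  [/\ left_invariant, outer_regular & inner_regular].

End Haar.

Inductive term (n : nat) : Type :=
  | Var of 'I_n
  | One
  | Mul of term n & term n
  | Inv of term n.

Arguments One {n}.

(* [formula n] is the type of formulae whose free variables are among the [n]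
   variables numbered by ['I_n]; a quantifier binds the last one, [ord_max]. *)
Inductive formula : nat -> Type :=
  | Eq n of term n & term n : formula n
  | Not n of formula n : formula n
  | And n of formula n & formula n : formula n
  | Or n of formula n & formula n : formula n
  | Imp n of formula n & formula n : formula n
  | All n of formula n.+1 : formula n
  | Ex n of formula n.+1 : formula n.

Section Satisfaction.
Variable G : groupType.

Fixpoint term_val n (e : 'I_n -> G) (t : term n) : G :=
  match t with
  | Var i => e i
  | One => 1%g
  | Mul s t => (term_val e s * term_val e t)%g
  | Inv s => ((term_val e s)^-1)%g
  end.

Definition env_rcons n (e : 'I_n -> G) (a : G) (i : 'I_n.+1) : G :=
  if unlift ord_max i is Some j then e j else a.

Fixpoint holds n (phi : formula n) : ('I_n -> G) -> Prop :=
  match phi with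
  | Eq _ s t => fun e => term_val e s = term_val e t
  | Not _ f => fun e => ~ holds f e
  | And _ f g => fun e => holds f e /\ holds g e
  | Or _ f g => fun e => holds f e \/ holds g e
  | Imp _ f g => fun e => holds f e -> holds g e
  | All _ f => fun e => forall a, holds f (env_rcons e a)
  | Ex _ f => fun e => exists a, holds f (env_rcons e a)
  end.

Definition solutions (phi : formula 1) : set G :=
  [set g | holds phi (fun=> g)].

End Satisfaction.

Arguments solutions G phi : clear implicits.

Definition spec (R : realType) (G : topologicalGroupType)
    (mu : probability (borel G) R) (F : set (formula 1)) : set (\bar R) :=
  [set mu (solutions G phi) | phi in F].

(* The letter [(i, b)] stands for the [i]-th generator if [b] is [false] and for
   its inverse if [b] is [true]. *)
Definition letter (n : nat) : Type := ('I_n * bool)%type.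

Definition reduced n (s : seq (letter n)) : bool :=
  sorted (fun a b => ~~ ((a.1 == b.1) && (a.2 != b.2))) s.

(* Elements of the free group of rank [n], as reduced words. *)
Definition free_word (n : nat) : Type := {s : seq (letter n) | reduced s}.

Definition expsum n (w : free_word n) (i : 'I_n) : int :=
  (\sum_(a <- val w | a.1 == i) (-1) ^+ a.2)%R.

Definition term_of_letter n (a : letter n) : term n :=
  if a.2 then Inv (Var a.1) else Var a.1.

Definition term_of_word n (w : free_word n) : term n :=
  foldr (fun a t => Mul (term_of_letter a) t) One (val w).

(* In a word in [k.+1] variables, [x] is the variable [ord0] and the [y_i] are
   the variables [lift ord0 i], for [i : 'I_k]. *)
Definition word (k : nat) : Type := free_word k.+1.

Definition nvar k (w : word k) : nat := k.+1.

(* The sign is such that, modulo commutators, [w = 1] reads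
   [x ^ nword w = prod_i y_i ^ yexp w i]. *)
Definition nword k (w : word k) : int := (- expsum w ord0)%R.

Definition yexp k (w : word k) (i : 'I_k) : int := expsum w (lift ord0 i).

(* [gcdz] is nonnegative and [gcdz 0 0 = 0], so this is [0] exactly when all
   the exponent sums [yexp w i] vanish, in particular for [k = 0]. *)
Definition ygcd k (w : word k) : int := \big[gcdz/0%R]_(i < k) yexp w i.

Section ZeroOne.
Local Open Scope ring_scope.

Definition pd_zero_one (p d k : nat) (w : word k) : Prop :=
  [\/ nword w = 0,
      nword w <> 0 /\ (ygcd w %| nword w)%Z,
      nword w <> 0 /\ ygcd w = 0
    | [/\ nword w <> 0, ygcd w <> 0, ~~ (ygcd w %| nword w)%Z,
          (p %| gcdz (1 - nword w) (ygcd w))%Z & (nvar w <= d - 1)%N]].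

End ZeroOne.

Definition zero_one (d k : nat) (w : word k) : Prop :=
  exists p : nat, prime p /\ pd_zero_one p d w.

Fixpoint exists_all k : formula k.+1 -> formula 1 :=
  match k with
  | 0 => fun phi => phi
  | k'.+1 => fun phi => exists_all (Ex phi)
  end.

Definition eta k (w : word k) : formula 1 :=
  exists_all (Eq (term_of_word w) One).

Definition zero_one_family (d : nat) : set (formula 1) :=
  [set phi | exists k (w : word k), zero_one d w /\ phi = eta w].

(* Main.v *)
(* If l(w) | n(w), Bezout gives integers c_i such that y_i = x^{c_i} solves
   w(x, y) = 1 for every x.  In the remaining cases the closed solution set is
   null.  If l(w) = 0, map G onto F_q for a prime q not dividing n(w): solutions
   lie in the kernel, of measure 1/q.

   In case (4) write d = m + 1, so k < m.  For a prime q not dividing n(w) and a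
   nonzero c in F_q^m, send one free generator to the delta function at 0 in the
   base of the wreath product F_p wr F_q, and the others to the elements c_i of
   F_q.  The kernel of this map psi_c has measure at most p^{-q}.  Since k < m,
   for every y some c <> 0 makes all psi_c(y_j) lie in the base group.  Then
   w(x, y) = 1 first forces psi_c(x) into the base group, as q does not divide
   n(w), and then psi_c(x) = 1, as p | l(w) and p | 1 - n(w).  So the solution
   set is covered by fewer than q^m kernels, and q^m / p^q tends to 0. *)

Require Import Defs.
From HB Require Import structures.
From mathcomp Require Import all_boot all_order all_algebra.
From mathcomp Require Import all_classical all_reals all_analysis.
From mathcomp Require Import zify.

Local Open Scope classical_set_scope.

Set Implicit Arguments.
Unset Strict Implicit.
Unset Printing Implicit Defensive.

Import Order.TTheory GRing.Theory Num.Theory.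

(** * Words and terms *)

Lemma term_val_morph (G H : groupType) (phi : G -> H) n (e : 'I_n -> G) t :
  {morph phi : x y / (x * y)%g} ->
  phi (term_val e t) = term_val (phi \o e) t.
Proof.
move=> phiM.
have phi1 : phi 1%g = 1%g.
  by apply: (mulgI (phi 1%g)); rewrite -phiM !mulg1.
have phiV x : phi x^-1%g = (phi x)^-1%g.
  by apply: (mulgI (phi x)); rewrite -phiM !mulgV.
by elim: t => //= [s <- t <-|s <-].
Qed.

(* [r] is the graph of a partial homomorphism between [V] and [G], in either
   direction. *)
Lemma term_val_expsum (V : zmodType) (G : groupType) (r : V -> G -> Prop)
    n (c : 'I_n -> V) (e : 'I_n -> G) (w : free_word n) :
  r 0%R 1%g ->
  (forall a b x y, r a x -> r b y -> r (a + b)%R (x * y)%g) ->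
  (forall a x, r a x -> r (- a)%R x^-1%g) ->
  (forall i, r (c i) (e i)) ->
  r (\sum_i c i *~ expsum w i)%R (term_val e (term_of_word w)).
Proof.
move=> r1 rM rV rce.
have -> : (\sum_i c i *~ expsum w i =
    \sum_(a <- val w) c a.1 *~ (-1) ^+ a.2)%R.
  rewrite /expsum; under eq_bigr do rewrite mulrz_sumr.
  rewrite (exchange_big_dep xpredT) //=; apply: eq_bigr => a _.
  by rewrite (big_pred1 a.1) // => i; rewrite /= eq_sym.
rewrite /term_of_word; elim: (val w) => [|[i b] s IH] /=.
  by rewrite big_nil.
rewrite big_cons; apply: rM => //.
by case: b => /=; rewrite ?mulrN1z ?mulr1z //; apply: rV.
Qed.

Definition eta_sol (G : groupType) k (w : word k) : set G :=
  [set g | exists2 e : 'I_k.+1 -> G, e ord0 = g &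
                                     term_val e (term_of_word w) = 1%g].

Arguments eta_sol G {k} w.

(** Each quantifier binds the last variable, so the one left free is always [ord0]; induction on [k]
    peels off [ord_max]. *)
Lemma solutions_exists_all (G : groupType) k (phi : formula k.+1) :
  solutions G (exists_all phi) =
  [set g | exists2 e : 'I_k.+1 -> G, e ord0 = g & holds phi e].
Proof.
elim: k phi => [|k IH] phi.
  apply/seteqP; split => g /=; rewrite /solutions /=.
    by move=> h; exists (fun=> g).
  move=> [e <-]; congr (holds phi _); apply/funext => i.
  by rewrite (ord1 i).
have lift0 : ord0 = lift ord_max (ord0 : 'I_k.+1) by apply: val_inj.
rewrite /= IH; apply/seteqP; split => g /=.
  move=> [e <- [a h]]; exists (env_rcons e a) => //.
  by rewrite /env_rcons lift0 liftK.
move=> [e <- h]; exists (fun i => e (lift ord_max i)); first by rewrite lift0.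
exists (e ord_max); congr (holds phi _): h; apply/funext => i.
by rewrite /env_rcons; case: unliftP => [j ->|->].
Qed.

Lemma solutions_eta (G : groupType) k (w : word k) :
  solutions G (Defs.eta w) = eta_sol G w.
Proof. exact: solutions_exists_all. Qed.

Lemma int_power_solution (G : groupType) n (w : free_word n) (g : G)
    (c : 'I_n -> int) :
  (\sum_i c i * expsum w i = 0)%R ->
  exists2 e : 'I_n -> G, (forall i, c i = 1%R -> e i = g) &
    term_val e (term_of_word w) = 1%g.
Proof.
(* [r] is the graph of the map from [z] to [g ^ z]; writing [z] as a difference of naturals treats
   both signs at once. *)
pose r (z : int) x := exists m n : nat,
  z = (m%:Z - n%:Z)%R /\ x = (g ^+ m / g ^+ n)%g.
move=> c0.
pose e i := match c i with Posz m => (g ^+ m)%g | Negz m => (g ^- m.+1)%g end.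
exists e; first by rewrite /e => i ->.
have sum0 : (\sum_i c i *~ expsum w i = 0)%R.
  by rewrite -[RHS]c0; apply: eq_bigr => i _; rewrite mulrzz.
suff: r 0%R (term_val e (term_of_word w)).
  by move=> [m [m' [/esym/subr0_eq[->] ->]]]; exact: mulgV.
rewrite -sum0.
apply: term_val_expsum => [|a b x y [m [n1 [-> ->]]] [m' [n1' [-> ->]]]
  |a x [m [n1 [-> ->]]]|i].
- by exists 0, 0; rewrite mulgV.
- exists (m + m'), (n1 + n1'); split; first by lia.
  have /commute_sym C : commute (g ^+ m' / g ^+ n1')%g (g ^- n1)%g.
    apply/commuteV/commute_sym/commuteM; last apply: commuteV;
    exact: commuteX2.
  by rewrite !expgnDr invgM -!mulgA (mulgA _ _ (g ^- n1)%g) -C.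
- by exists n1, m; rewrite opprB invgM invgK.
- rewrite /e; case: (c i) => m; first by exists m, 0; rewrite subr0 invg1 mulg1.
  by exists 0, m.+1; rewrite mul1g; split=> //; lia.
Qed.

(** * Haar measure *)

Lemma continuous_mulg (T : topologicalType) (G : topologicalGroupType)
    (f g : T -> G) :
  continuous f -> continuous g -> continuous (fun x => (f x * g x)%g).
Proof.
move=> cf cg x.
apply: (@continuous_comp T (G * G)%type G (fun x => (f x, g x))
  (fun xy : G * G => (xy.1 * xy.2)%g)); last exact: mulg_continuous.
exact: cvg_pair (cf x) (cg x).
Qed.

Lemma continuous_term_val (G : topologicalGroupType) n (t : term n) :
  continuous (fun e : {ptws 'I_n -> G} => term_val e t).
Proof.
elim: t => [i||s cs t ct|t ct] /=.
- exact: (@proj_continuous _ (fun=> G) i).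
- exact: cst_continuous.
- exact: continuous_mulg.
- by move=> e; apply: continuous_comp (ct e) _; exact: invg_continuous.
Qed.

(** All solutions [(x, y)] form a closed subset of a power of [G], compact by Tychonoff; its
    projection to the coordinate of x is compact, hence closed as [G] is Hausdorff. *)
Lemma closed_eta_sol (G : profiniteGroupType) k (w : word k) :
  closed (eta_sol G w).
Proof.
pose S := [set e : {ptws 'I_k.+1 -> G} | term_val e (term_of_word w) = 1%g].
have -> : eta_sol G w = (fun e : {ptws 'I_k.+1 -> G} => e ord0) @` S.
  by apply/seteqP; split => g /= [e]; [exists e|move=> ? <-; exists e].
apply: compact_closed; first exact: profinite_hausdorff.
apply: continuous_compact.
  by apply: continuous_subspaceT; exact: (@proj_continuous _ (fun=> G) ord0).
apply: (@subclosed_compact _ _ setT) => //.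
  apply: (@preimage_closed _ _ _ [set 1%g]).
    by move=> e _; exact: continuous_term_val.
  apply: accessible_closed_set1; apply: hausdorff_accessible.
  exact: profinite_hausdorff.
have := @tychonoff 'I_k.+1 (fun=> G) (fun=> setT) (fun=> profinite_compact).
by congr compact; apply/seteqP; split.
Qed.

Section Borel.
Variables (R : realType) (G : topologicalGroupType).
Variable mu : probability (borel G) R.

Lemma open_borel (U : set G) : open U -> measurable (U : set (borel G)).
Proof. by move=> oU; exact: sub_sigma_algebra. Qed.

Lemma closed_borel (U : set G) : closed U -> measurable (U : set (borel G)).
Proof.
move=> cU; rewrite -[U]setCK; apply: (@measurableC _ (borel G)).
by apply: open_borel; rewrite openC.
Qed.

Lemma left_translate_open (g : G) (A : set G) :
  open A -> open [set (g * a)%g | a in A].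
Proof.
move=> oA; rewrite (_ : [set _ | _ in A] = (fun x => (g^-1 * x)%g) @^-1` A).
  apply: open_comp => // x _; apply: continuous_mulg => [?|y].
    exact: cvg_cst.
  exact: cvg_id.
apply/seteqP; split => x /=; first by move=> [a Aa <-]; rewrite mulKg.
by move=> Ax; exists (g^-1 * x)%g => //; rewrite mulVKg.
Qed.

(** Disjoint translates of equal measure fit into total mass 1. With coset representatives for [g],
    this bounds the measure of an open kernel by the inverse of the number of cosets. *)
Lemma probability_translates (A : set G) (I : finType) (g : I -> G) :
  left_invariant mu -> open A ->
  (forall i j a b, A a -> A b -> (g i * a = g j * b)%g -> i = j) ->
  (#|I|%:R%:E * mu A <= 1)%E.
Proof.
move=> inv oA disj.
pose F (i : 'I_#|I|) : set (borel G) := [set (g (enum_val i) * a)%g | a in A].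
have mF i : measurable (F i) by apply: open_borel; exact: left_translate_open.
have mU : measurable (\big[setU/set0]_(i < #|I|) F i).
  by apply: bigsetU_measurable.
have : (mu (\big[setU/set0]_(i < #|I|) F i) <= 1)%E by exact: probability_le1.
rewrite measure_semi_additive_ord //; last first.
  move=> i j _ _ [x [[a Aa <-] [b Ab /esym/disj]]] => /(_ Aa Ab).
  exact: enum_val_inj.
rewrite (eq_bigr (fun=> mu A)); last first.
  by move=> i _; apply: inv; exact: open_borel.
by rewrite sumr_const card_ord mule_natl.
Qed.

(** For nonempty [I], subadditivity bounds the measure of [S] by [#|I| / m], which is at most
    [1 / N] for every positive [N]. *)
Lemma null_cover (S : set G) :
  measurable (S : set (borel G)) ->
  (forall N, exists (I : finType) (m : nat) (K : I -> set G),
     [/\ (N * #|I| <= m)%N, S `<=` \bigcup_i K i &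
         forall i, open (K i) /\ (m%:R%:E * mu (K i) <= 1)%E]) ->
  mu S = 0%E.
Proof.
move=> mS cov; have fS : mu S \is a fin_num by exact: fin_num_measure.
have [r muS] : exists r, mu S = r%:E by exists (fine (mu S)); rewrite fineK.
have r_ge0 : (0 <= r)%R by rewrite -lee_fin -muS.
rewrite muS; congr EFin; apply/eqP; rewrite eq_le r_ge0 andbT leNgt.
apply/negP => r_gt0.
have [N ltN] : exists N, (r^-1 < N%:R)%R.
  by exists (Num.truncn r^-1).+1; rewrite truncnS_gt.
have [I [m [K [leN SK oK]]]] := cov N.
have I_gt0 : (0 < #|I|)%N.
  rewrite lt0n; apply/negP => /eqP I0.
  suff S0 : S = set0 by move: r_gt0; rewrite -lte_fin -muS S0 measure0 ltxx.
  apply/seteqP; split => // x /SK[i _].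
  by have : i \in I; rewrite // (card0_eq I0).
have muSI : (m%:R * r <= #|I|%:R)%R.
  pose F (i : nat) : set (borel G) :=
    K (nth (enum_val (Ordinal I_gt0)) (enum I) i).
  have mF i : measurable (F i) by apply: open_borel; exact: (oK _).1.
  have SF : S `<=` \big[setU/set0]_(i < #|I|) F i.
    rewrite -bigcup_mkord => x /SK [i _ Kx]; exists (index i (enum I)).
      by rewrite /= cardE index_mem mem_enum.
    by rewrite /F nth_index ?mem_enum.
  have := content_subadditive mu (fun k _ => mF k) mS SF.
  rewrite -lee_fin EFinM -muS => /(lee_wpmul2l (_ : 0 <= m%:R%:E)%E).
  rewrite lee_fin ler0n => /(_ isT) /le_trans; apply.
  rewrite ge0_sume_distrr; last by move=> *; exact: measure_ge0.
  apply: (le_trans (lee_sum _ (fun i _ => (oK (nth _ _ (i : 'I_#|I|))).2))).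
  by rewrite sumEFin sumr_const card_ord.
have : (N%:R * r <= 1)%R.
  rewrite -(ler_pM2l (_ : 0 < #|I|%:R)%R) ?ltr0n // mulr1 mulrA -natrM mulnC.
  by apply: le_trans muSI; rewrite ler_wpM2r // ler_nat.
by rewrite -ler_pdivlMr // mul1r leNgt ltN.
Qed.

End Borel.

(** * Wreath products as discrete profinite groups *)

(** Base function first, top element second; [E] acts on the base by the translations [wshift]. The
    pairs with zero base form a copy of [E], so abelian targets come from the same construction. *)
Definition wreath (V E : finZmodType) : Type := ({ffun E -> V} * E)%type.

Section Wreath.
Variables V E : finZmodType.
Local Open Scope ring_scope.

HB.instance Definition _ := Finite.on (wreath V E).

Definition wshift (e : E) (f : {ffun E -> V}) : {ffun E -> V} :=
  [ffun x => f (x - e)].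

Definition wmul (u v : wreath V E) : wreath V E :=
  (u.1 + wshift u.2 v.1, u.2 + v.2).

Definition winv (u : wreath V E) : wreath V E :=
  (- wshift (- u.2) u.1, - u.2).

Lemma wmulA : associative wmul.
Proof.
move=> [f a] [g b] [h c]; rewrite /wmul /= addrA; congr pair.
apply/ffunP => x; rewrite !ffunE addrA; congr (_ + h _).
by rewrite opprD addrA.
Qed.

Lemma wmul1 : left_id ((0, 0) : wreath V E) wmul.
Proof.
move=> [f a]; rewrite /wmul /= !add0r; congr pair.
by apply/ffunP => x; rewrite ffunE subr0.
Qed.

Lemma w1mul : right_id ((0, 0) : wreath V E) wmul.
Proof.
move=> [f a]; rewrite /wmul /= addr0; congr pair.
by apply/ffunP => x; rewrite !ffunE addr0.
Qed.

Lemma wmulV : left_inverse ((0, 0) : wreath V E) winv wmul.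
Proof. by move=> [f a]; rewrite /wmul /= !addNr. Qed.

Lemma wVmul : right_inverse ((0, 0) : wreath V E) winv wmul.
Proof.
move=> [f a]; rewrite /wmul /= subrr; congr pair.
by apply/ffunP => x; rewrite !ffunE opprK subrK subrr.
Qed.

HB.instance Definition _ :=
  isGroup.Build (wreath V E) wmulA wmul1 w1mul wmulV wVmul.

Lemma wreath_mulE (u v : wreath V E) :
  (u * v)%g = (u.1 + wshift u.2 v.1, u.2 + v.2).
Proof. by []. Qed.

Lemma wreath_invE (u : wreath V E) :
  (u^-1)%g = (- wshift (- u.2) u.1, - u.2).
Proof. by []. Qed.

HB.instance Definition _ := hasNbhs.Build (wreath V E) principal_filter.
HB.instance Definition _ := Discrete_ofNbhs.Build (wreath V E) erefl.

Lemma wreath_mul_continuous :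
  continuous (fun uv : wreath V E * wreath V E => (uv.1 * uv.2)%g).
Proof.
move=> [u v]; apply/discrete_cvg.
exists ([set u], [set v]); first by split; exact: discrete_set1.
by move=> [u' v'] /= [-> ->].
Qed.

Lemma wreath_inv_continuous : continuous (fun u : wreath V E => (u^-1)%g).
Proof. by apply/continuousP => A _; exact: discrete_open. Qed.

HB.instance Definition _ := isTopologicalGroup.Build (wreath V E)
  wreath_mul_continuous wreath_inv_continuous.

Lemma wreath_compact : compact [set: wreath V E].
Proof. by apply: finite_compact; exact: finite_finset. Qed.

HB.instance Definition _ := isProfiniteGroup.Build (wreath V E)
  wreath_compact discrete_hausdorff
  (zero_dimension_totally_disconnected discrete_zero_dimension).

Lemma wreath_open (A : set (wreath V E)) : open A.
Proof. exact: discrete_open. Qed.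

End Wreath.

(** * Arithmetic *)

(** With [t] the integer part of the binary logarithm of [q], [q ^ r] is at most [2 ^ (t.+1 * r)],
    so it suffices that [t.+1 * r <= 2 ^ t <= q]. *)
Lemma exp_dominates_power r :
  exists B, forall q, (B <= q)%N -> (q ^ r <= 2 ^ q)%N.
Proof.
exists (2 ^ (4 * r).+1)%N => q leBq.
have q_gt0 : (0 < q)%N by apply: leq_trans leBq; rewrite expn_gt0.
set t := trunc_log 2 q.
have [leq_t ltq_t] :=
  (trunc_logP (isT : 1 < 2) q_gt0, trunc_log_ltn q (isT : 1 < 2)).
rewrite -/t in leq_t ltq_t.
have le_t : (4 * r < t.+1)%N.
  rewrite -(ltn_exp2l _ _ (isT : 1 < 2)%N); apply: leq_ltn_trans ltq_t.
  by apply: leq_trans leBq; rewrite leq_exp2l.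
apply: (@leq_trans (2 ^ (t.+1 * r))).
  by rewrite expnM; case: r {leBq le_t} => // r; rewrite leq_exp2r // ltnW.
rewrite leq_exp2l //; apply: leq_trans leq_t.
(* Of two factors [2 ^ t./2], one exceeds [t./2] and the other is at least [2 * r], because
   [4 * r <= t]. *)
have tE : t = (t./2 + t./2 + odd t)%N by rewrite addnn addnC odd_double_half.
have ltE := @ltn_expl 2 t./2 isT.
have le_h : (2 * r <= 2 ^ t./2)%N by apply: leq_trans (ltnW ltE); lia.
apply: (@leq_trans (2 ^ (t./2 + t./2))); last by rewrite leq_exp2l //; lia.
rewrite expnD; apply: (@leq_trans ((t./2).+1 * (2 * r))); last exact: leq_mul.
rewrite mulnCA mulnA leq_mul2r; apply/orP; right; lia.
Qed.

Lemma ygcd_dvd k (w : word k) i : (ygcd w %| yexp w i)%Z.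
Proof.
rewrite /ygcd; elim: (index_enum _) (mem_index_enum i) => // j s IH.
rewrite inE big_cons => /orP[/eqP<-|/IH]; first exact: dvdz_gcdl.
by apply: dvdz_trans; exact: dvdz_gcdr.
Qed.

(** The integer combinations of the exponent sums contain each of them and, by Bezout for two
    integers, are closed under [gcdz]. *)
Lemma ygcd_bezout k (w : word k) :
  exists c : 'I_k -> int, ygcd w = (\sum_i c i * yexp w i)%R.
Proof.
pose K z := exists c : 'I_k -> int, z = (\sum_i c i * yexp w i)%R.
rewrite -/(K _) /ygcd; apply: (big_ind K) => [|a b [c ->] [c' ->]|i _].
- by exists (fun=> 0%R); rewrite big1 // => i _; rewrite mul0r.
- have [u [v <-]] :=
    Bezoutz (\sum_i c i * yexp w i)%R (\sum_i c' i * yexp w i)%R.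
  exists (fun i => u * c i + v * c' i)%R; rewrite !mulr_sumr -big_split.
  by apply: eq_bigr => i _; rewrite mulrDl !mulrA.
- exists (fun j => (j == i)%:R%R).
  rewrite (bigD1 i) //= eqxx mul1r big1 ?addr0 //.
  by move=> j /negPf->; rewrite mul0r.
Qed.

Lemma eta_sol_full (G : groupType) k (w : word k) :
  (ygcd w %| nword w)%Z -> eta_sol G w = setT.
Proof.
move=> /dvdzP[t nE]; apply/seteqP; split=> // g _.
have [c ygcdE] := ygcd_bezout w.
(* Exponent 1 for x and [t * c j] for y_j: the total exponent of [g] is
   [- nword w + t * ygcd w = 0]. *)
pose c' (i : 'I_k.+1) : int :=
  if unlift ord0 i is Some j then (t * c j)%R else 1%R.
have [|e eg ew] := @int_power_solution G _ w g c'.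
  rewrite big_ord_recl /c' unlift_none mul1r.
  under eq_bigr do rewrite liftK -mulrA.
  by rewrite -mulr_sumr -ygcdE -nE /nword subrr.
by exists e => //; apply: eg; rewrite /c' unlift_none.
Qed.

Lemma mulrz_Fp_eq0 (q : nat) (a : 'F_q) (z : int) :
  prime q -> ~~ (q %| `|z|)%N -> (a *~ z = 0)%R -> a = 0%R.
Proof.
move=> pq qz /eqP; rewrite -mulrzr mulf_eq0 => /orP[/eqP//|].
have chq := pchar_Fp pq.
suff -> : (z%:~R == 0 :> 'F_q)%R = (q %| `|z|)%N by rewrite (negPf qz).
rewrite (dvdn_pcharf chq); case: z {qz} => m //.
by rewrite NegzE mulrNz oppr_eq0.
Qed.

Lemma mulrz_ffun_Fp (T : finType) (p : nat) (f : {ffun T -> 'F_p}) (z : int) :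
  prime p -> (p %| z)%Z -> (f *~ z = 0)%R.
Proof.
move=> pp /dvdzP[t ->]; rewrite mulrzA -pmulrn; apply/ffunP => x.
by rewrite ffunMnE ffunE -mulr_natr pchar_Fp_0 // mulr0.
Qed.

(** * Words in wreath products *)

Section WreathWords.
Variables V E : finZmodType.
Local Open Scope ring_scope.

Lemma wshift0 (e : E) : wshift e 0 = 0 :> {ffun E -> V}.
Proof. by apply/ffunP => x; rewrite !ffunE. Qed.

Lemma wshift_id (f : {ffun E -> V}) : wshift 0 f = f.
Proof. by apply/ffunP => x; rewrite ffunE subr0. Qed.

Definition wbase (f : {ffun E -> V}) : wreath V E := (f, 0).

Lemma wbaseD (f g : {ffun E -> V}) : wbase (f + g) = (wbase f * wbase g)%g.
Proof. by rewrite wreath_mulE /= wshift_id addr0. Qed.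

Lemma term_val_snd n (e : 'I_n -> wreath V E) (w : free_word n) :
  (term_val e (term_of_word w)).2 = \sum_i (e i).2 *~ expsum w i.
Proof.
by apply/esym; apply: (@term_val_expsum E (wreath V E) (fun a u => a = u.2)
  n (fun i => (e i).2) e w) => // [a b x y -> ->|a x ->].
Qed.

Lemma term_val_base n (f : 'I_n -> {ffun E -> V}) (w : free_word n) :
  term_val (fun i => wbase (f i)) (term_of_word w) =
  wbase (\sum_i f i *~ expsum w i).
Proof.
apply: (@term_val_expsum {ffun E -> V} (wreath V E)
  (fun a u => u = wbase a)) => //.
  by move=> a b x y -> ->; rewrite wbaseD.
by move=> a x ->; rewrite wreath_invE /= oppr0 wshift_id.
Qed.

End WreathWords.

Definition wdelta (p q : nat) : {ffun 'F_q -> 'F_p} :=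
  [ffun x => (x == 0)%:R]%R.

(** Multiples of [c] fill F_q; conjugation by them moves the delta function to every point, and the
    translates span the base. Finiteness supplies inverses, so closure under products suffices. *)
Lemma wreath_base_generated p q (P : wreath 'F_p 'F_q -> Prop) (c : 'F_q) :
  prime p -> prime q -> c != 0%R ->
  P 1%g -> (forall u v, P u -> P v -> P (u * v)%g) ->
  P (wbase (wdelta p q)) -> P (0%R, c) -> forall f, P (wbase f).
Proof.
move=> pp pq c0 P1 PM Pd Pc.
have Pnat n : P (0%R, c *+ n)%R.
  elim: n => [//|n IH]; have := PM _ _ Pc IH.
  by rewrite wreath_mulE /= wshift0 addr0 -mulrS.
have Pb (b : 'F_q) : P (0%R, b).
  suff -> : b = (c *+ (b / c)%R)%R by [].
  by rewrite -mulr_natr natr_Zp mulrC divfK.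
have Pde (b : 'F_q) : P (wbase (wshift b (wdelta p q))).
  (* Conjugating the delta function by [(0, b)] translates it by [b]. *)
  have := PM _ _ (PM _ _ (Pb b) Pd) (Pb (- b)%R).
  by rewrite !wreath_mulE /= wshift0 add0r !addr0 subrr.
have PD f g : P (wbase f) -> P (wbase g) -> P (wbase (f + g)%R).
  by move=> Pf Pg; rewrite wbaseD; exact: PM.
have PMn f n : P (wbase f) -> P (wbase (f *+ n)%R).
  by move=> Pf; elim: n => [//|n IH]; rewrite mulrS; exact: PD.
move=> f.
have -> : f = (\sum_b wshift b (wdelta p q) *+ f b)%R.
  apply/ffunP => x; rewrite sum_ffunE (bigD1 x) //= big1 => [|b bx].
    by rewrite ffunMnE !ffunE subrr eqxx addr0 natr_Zp.
  by rewrite ffunMnE !ffunE subr_eq0 eq_sym (negPf bx) mul0rn.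
by elim/big_rec: _ => [//|b g _ Pg]; apply: PD => //; exact: PMn.
Qed.

Lemma continuous_discrete_comp (T S : topologicalType)
    (D : discreteTopologicalType) (f : T -> D) (h : D -> S) :
  continuous f -> continuous (h \o f).
Proof.
move=> /continuousP cf; apply/continuousP => A _.
rewrite comp_preimage; exact/cf/discrete_open.
Qed.

(** * Wreath product quotients of free profinite groups *)

Definition magnus_gen m p q (c : 'rV['F_q]_m) (i : 'I_m.+1) :
    wreath 'F_p 'F_q :=
  if unlift ord0 i is Some j then (0, c ord0 j)%R else wbase (wdelta p q).
Arguments magnus_gen {m} p {q} c i.

Section FreeProfinite.
Variables (m : nat) (G : profiniteGroupType) (x : 'I_m.+1 -> G).
Hypothesis xfree : forall (H : profiniteGroupType) (f : 'I_m.+1 -> H),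
  exists! phi : G -> H,
    continuous_morphism phi /\ forall i, phi (x i) = f i.

Lemma free_ext (H : profiniteGroupType) (phi psi : G -> H) :
  continuous_morphism phi -> continuous_morphism psi ->
  (forall i, phi (x i) = psi (x i)) -> phi = psi.
Proof.
move=> cphi cpsi eqx; have [chi [_ uniq]] := xfree (psi \o x).
by rewrite -(uniq phi) ?(uniq psi).
Qed.

Variables p q : nat.
Hypotheses (pp : prime p) (pq : prime q).

Lemma free_wreath_family :
  exists psi : 'rV['F_q]_m -> G -> wreath 'F_p 'F_q,
    (forall c, continuous_morphism (psi c)) /\
    (forall c i, psi c (x i) = magnus_gen p c i).
Proof.
have /choice[psi psiP] (c : 'rV['F_q]_m) : exists phi : G -> wreath 'F_p 'F_q,
    continuous_morphism phi /\ forall i, phi (x i) = magnus_gen p c i.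
  by have [phi [phiP _]] := xfree (magnus_gen p c); exists phi.
by exists psi; split => c; have [] := psiP c.
Qed.

Variable psi : 'rV['F_q]_m -> G -> wreath 'F_p 'F_q.
Hypothesis psi_morph : forall c, continuous_morphism (psi c).
Hypothesis psi_gen : forall c i, psi c (x i) = magnus_gen p c i.

Lemma psiM c : {morph psi c : g h / (g * h)%g}.
Proof. by case: (psi_morph c). Qed.

Lemma psi1 c : psi c 1%g = 1%g.
Proof. by apply: (mulgI (psi c 1%g)); rewrite -psiM !mulg1. Qed.

Lemma psi_open c (A : set (wreath 'F_p 'F_q)) : open (psi c @^-1` A).
Proof.
by have [_ /continuousP] := psi_morph c; apply; exact: wreath_open.
Qed.

(** The image of [psi c] contains the whole base group, so its kernel has at least [p ^ q]
    cosets. *)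
Lemma psi_base c f : c != 0%R -> exists g, psi c g = wbase f.
Proof.
move=> /rV0Pn[i ci].
apply: (@wreath_base_generated _ _ (fun u => exists g, psi c g = u)
  (c ord0 i)) => //.
- by exists 1%g; exact: psi1.
- by move=> _ _ [g <-] [h <-]; exists (g * h)%g; exact: psiM.
- by exists (x ord0); rewrite psi_gen /magnus_gen unlift_none.
- by exists (x (lift ord0 i)); rewrite psi_gen /magnus_gen liftK.
Qed.

(** [v g] is the vector of exponents of [g] modulo [q] in the generators other than [x ord0]; a
    single [v] serves all [c], which allows linear algebra in [c]. *)
Lemma psi_snd_linear : exists v : G -> 'rV['F_q]_m,
  forall c g, (psi c g).2 = (\sum_i c ord0 i * v g ord0 i)%R.
Proof.
(* The target F_q^m is realised as the top group of a wreath product, which is already known to be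
   profinite. *)
pose gen (i : 'I_m.+1) : wreath 'F_p 'rV['F_q]_m :=
  if unlift ord0 i is Some j then (0, delta_mx 0 j)%R else 1%g.
have [phi [[[phiM phic] phi_gen] _]] := xfree gen.
exists (fun g => (phi g).2) => c g.
pose dot (v : 'rV['F_q]_m) := (\sum_i c ord0 i * v ord0 i)%R.
(* Both sides, padded with a zero base, are continuous morphisms to the wreath product; it remains
   to compare them on generators. *)
pose Phi1 g : wreath 'F_p 'F_q := (0%R, (psi c g).2).
pose Phi2 g : wreath 'F_p 'F_q := (0%R, dot (phi g).2).
suff : Phi1 = Phi2 by move=> /(congr1 (@^~ g))[].
apply: free_ext.
- split=> [a b|]; first by rewrite /Phi1 psiM !wreath_mulE /= wshift0 addr0.
  apply: (@continuous_discrete_comp G (wreath 'F_p 'F_q) (wreath 'F_p 'F_q)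
    (psi c) (fun u => (0%R, u.2))).
  exact: (psi_morph c).2.
- split=> [a b|].
    rewrite /Phi2 phiM !wreath_mulE /= wshift0 addr0; congr pair.
    rewrite /dot -big_split; apply: eq_bigr => i _.
    by rewrite mxE mulrDr.
  by apply: (@continuous_discrete_comp G (wreath 'F_p 'F_q)
    (wreath 'F_p 'rV['F_q]_m) phi (fun u => (0%R, dot u.2))).
move=> i; rewrite /Phi1 /Phi2 psi_gen phi_gen /magnus_gen /gen /dot.
case: unliftP => [j|] _ /=; congr pair.
  rewrite (bigD1 j) //= mxE !eqxx mulr1 big1 ?addr0 // => k kj.
  by rewrite mxE (negPf kj) mulr0.
by rewrite big1 // => k _; rewrite mxE mulr0.
Qed.

Lemma eta_sol_kernel k (w : word k) g :
  (k < m)%N -> (p %| ygcd w)%Z -> (p %| (1 - nword w)%R)%Z ->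
  ~~ (q %| `|nword w|)%N -> eta_sol G w g ->
  exists2 c, c != 0%R & psi c g = 1%g.
Proof.
move=> km pl pn qn [e <- ew].
have [v vE] := psi_snd_linear.
(* The columns are the exponent vectors of the y_j. As [k < m], the left kernel is nonzero and
   provides [c] orthogonal to all of them. *)
pose M : 'M['F_q]_(m, k) := (\matrix_(i, j) v (e (lift ord0 j)) ord0 i)%R.
pose c := nz_row (kermx M).
have cM : (c *m M = 0)%R by apply/eqP; rewrite -sub_kermx nz_row_sub.
have c0 : c != 0%R.
  rewrite nz_row_eq0 kermx_eq0 -row_leq_rank -ltnNge.
  exact: leq_ltn_trans (rank_leq_col M) km.
exists c => //.
have sndy j : (psi c (e (lift ord0 j))).2 = 0%R.
  rewrite vE -[RHS](_ : (c *m M) ord0 j = _)%R; last by rewrite cM mxE.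
  by rewrite mxE; apply: eq_bigr => i _; rewrite mxE.
have psiw : term_val (psi c \o e) (term_of_word w) = 1%g.
  by rewrite -term_val_morph ?ew ?psi1 //; exact: psiM.
(* The y_j have zero top component, so the top component of [w = 1] says that [nword w] kills that
   of x. *)
have sndx : (psi c (e ord0)).2 = 0%R.
  apply: (mulrz_Fp_eq0 pq qn).
  suff : ((psi c (e ord0)).2 *~ expsum w ord0 = 0)%R.
    by rewrite /nword mulrNz => ->; rewrite oppr0.
  have := congr1 snd psiw; rewrite term_val_snd big_ord_recl big1 ?addr0 //.
  by move=> i _; rewrite /= sndy mul0rz.
have baseE i : psi c (e i) = wbase (psi c (e i)).1.
  rewrite /wbase [LHS]surjective_pairing; congr pair.
  by case: (unliftP ord0 i) => [j|] ->.
rewrite baseE; have := congr1 fst psiw.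
rewrite (_ : psi c \o e = fun i => wbase (psi c (e i)).1); last exact/funext.
rewrite term_val_base big_ord_recl big1 ?addr0 => [|i _]; last first.
  by apply: mulrz_ffun_Fp => //; apply: dvdz_trans pl (ygcd_dvd w i).
move=> /= f0; congr (_, _).
(* The base component of x is killed by [nword w] and, modulo [p], by [1 - nword w], hence is
   zero. *)
have := mulrz_ffun_Fp (psi c (e ord0)).1 pp pn.
by rewrite mulrzBr mulr1z /nword mulrNz f0 oppr0 subr0.
Qed.

End FreeProfinite.

(** * Null solution sets and the zero-one alternative *)

Section Null.
Variables (R : realType) (m : nat) (G : profiniteGroupType).
Variable x : 'I_m.+1 -> G.
Hypothesis xfree : forall (H : profiniteGroupType) (f : 'I_m.+1 -> H),
  exists! phi : G -> H,
    continuous_morphism phi /\ forall i, phi (x i) = f i.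
Variable mu : probability (borel G) R.
Hypothesis mu_inv : left_invariant mu.

Lemma eta_sol_null_abelian k (w : word k) :
  (0 < m)%N -> nword w <> 0%R -> ygcd w = 0%R -> mu (eta_sol G w) = 0%E.
Proof.
case: m x xfree => // m' y yfree _ n0 l0.
apply: null_cover; first by apply: closed_borel; exact: closed_eta_sol.
move=> N; have [q lt_q pq] := prime_above (maxn N `|nword w|).
(* Only top components are used below, so the base prime is simply set to 2; the all-ones [c] makes
   the top component onto F_q. *)
have [psi [psi_morph psi_gen]] := free_wreath_family yfree 2 q.
pose c : 'rV['F_q]_m'.+1 := const_mx 1%R.
exists unit, q, (fun=> [set g | (psi c g).2 = 0%R]); split.
- by rewrite card_unit muln1; lia.
- move=> g [e <- ew]; exists tt => //=.
  apply: (@mulrz_Fp_eq0 q _ (nword w) pq).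
    by apply/negP => /dvdn_leq; rewrite absz_gt0 => /(_ (introN eqP n0)); lia.
  have : (term_val (psi c \o e) (term_of_word w)).2 = 0%R.
    by rewrite -term_val_morph ?ew ?(psi1 psi_morph) //; exact: psiM.
  rewrite term_val_snd big_ord_recl big1 ?addr0 => [|i _].
    by rewrite /nword mulrNz => /= ->; rewrite oppr0.
  have := ygcd_dvd w i; rewrite l0 dvd0z => /eqP yi0.
  by rewrite [expsum _ _]yi0 mulr0z.
- move=> _; have oK : open [set g | (psi c g).2 = 0%R].
    exact: (psi_open psi_morph c [set u | u.2 = 0%R]).
  split=> //; rewrite -[q in (q%:R)%R](card_Fp pq).
  (* Powers of one generator with top component 1 represent the [q] cosets. *)
  pose t (b : 'F_q) : G := (y (lift ord0 ord0) ^+ b)%g.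
  apply: (probability_translates (g := t)) => // i j a b /= a0 b0.
  have tE (z : 'F_q) : (psi c (t z)).2 = z.
    rewrite /t; have : forall n, (psi c (y (lift ord0 ord0) ^+ n)%g).2 = n%:R%R.
      elim=> [|n IH]; first by rewrite expg0 (psi1 psi_morph).
      rewrite expgS (psiM psi_morph) wreath_mulE /= IH psi_gen.
      by rewrite /magnus_gen liftK /= mxE -mulrS.
    by move=> ->; exact: natr_Zp.
  move=> /(congr1 (fun g => (psi c g).2)).
  by rewrite !(psiM psi_morph) !wreath_mulE /= !tE a0 b0 !addr0.
Qed.

Lemma eta_sol_null_frattini k (w : word k) p :
  prime p -> (k < m)%N -> nword w <> 0%R -> (p %| ygcd w)%Z ->
  (p %| (1 - nword w)%R)%Z -> mu (eta_sol G w) = 0%E.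
Proof.
move=> pp km n0 pl pn.
apply: null_cover; first by apply: closed_borel; exact: closed_eta_sol.
(* The exponent [m.+1] leaves a spare factor [q] to absorb [N]:
   [N * q ^ m <= q ^ m.+1 <= 2 ^ q <= p ^ q]. *)
move=> N; have [B Bq] := exp_dominates_power m.+1.
have [q lt_q pq] := prime_above (maxn B (maxn N `|nword w|)).
have [psi [psi_morph psi_gen]] := free_wreath_family xfree p q.
exists 'rV['F_q]_m, (p ^ q), (fun c => [set g | c != 0%R /\ psi c g = 1%g]).
split.
- rewrite card_mx card_Fp // mul1n; apply: (@leq_trans (q ^ m.+1)).
    by rewrite expnS leq_mul2r; apply/orP; right; lia.
  apply: (@leq_trans (2 ^ q)); first by apply: Bq; lia.
  by rewrite leq_exp2r ?prime_gt1 ?prime_gt0.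
- move=> g gw.
  have qn : ~~ (q %| `|nword w|)%N.
    by apply/negP => /dvdn_leq; rewrite absz_gt0 => /(_ (introN eqP n0)); lia.
  have [c c0 cg] := eta_sol_kernel xfree pp pq psi_morph psi_gen km pl pn qn gw.
  by exists c.
(* The cover is indexed by all vectors; the zero vector contributes the empty set. *)
- move=> c; have [->|c0] := eqVneq c 0%R.
    rewrite (_ : [set g | _] = set0); last by apply/seteqP; split => // g [].
    by split; [exact: open0|rewrite measure0 mule0].
  have oK : open [set g | true /\ psi c g = 1%g].
    exact: (psi_open psi_morph c [set u | true /\ u = 1%g]).
  split=> //; rewrite (_ : p ^ q = #|{ffun 'F_q -> 'F_p}|)%N; last first.
    by rewrite card_ffun !card_Fp.
  (* Preimages of the [p ^ q] base elements lie in distinct cosets of the kernel. *)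
  have /choice[t tE] f := psi_base pp pq psi_morph psi_gen f c0.
  apply: (probability_translates (g := t)) => // f f' a b /= [_ a1] [_ b1].
  move=> /(congr1 (psi c)).
  by rewrite !(psiM psi_morph) !tE a1 b1 !mulg1 => -[].
Qed.

Lemma eta_sol_zero_one k (w : word k) :
  (0 < m)%N -> zero_one m.+1 w ->
  mu (eta_sol G w) = 0%E \/ mu (eta_sol G w) = 1%E.
Proof.
move=> m0 [p [pp wp]].
have full : (ygcd w %| nword w)%Z -> mu (eta_sol G w) = 1%E.
  by move=> /eta_sol_full ->; exact: probability_setT.
case: wp => [n0|[n0 ln]|[n0 l0]|[n0 l0 _ pg km]].
- by right; apply: full; rewrite n0 dvdz0.
- by right; exact: full.
- by left; exact: eta_sol_null_abelian.
- left; move: pg; rewrite dvdz_gcd => /andP[pn pl].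
  apply: (eta_sol_null_frattini pp _ n0 pl pn).
  (* [nvar w] counts x too, so the bound [d - 1 = m] on it means [k < m]. *)
  by move: km; rewrite /nvar subn1.
Qed.

End Null.

Theorem corollary1p4 (R : realType) (d : nat) (hd : (2 <= d)%N)
    (G : profiniteGroupType) (hG : free_profinite d G)
    (mu : probability (borel G) R) (hmu : normalised_haar mu) :
  spec mu (zero_one_family d) = [set 0%E; 1%E].
Proof.
have [mu_inv _ _] := hmu.
case: d hd hG => [|m] // m0 [x xfree].
apply/seteqP; split.
  move=> _ [_ [k [w [zw ->]]] <-]; rewrite solutions_eta.
  by have [->|->] := eta_sol_zero_one xfree mu_inv m0 zw; [left|right].
have spec1 (w : word 0) : zero_one m.+1 w ->
    spec mu (zero_one_family m.+1) (mu (eta_sol G w)).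
  by move=> zw; exists (Defs.eta w); [exists 0%N, w|rewrite solutions_eta].
move=> _ [->|->].
(* The value 0 is attained by the word x, with no y variables. *)
- pose w : word 0 := exist _ [:: (ord0, false)] isT.
  have n0 : nword w <> 0%R by rewrite /nword /expsum big_cons big_nil.
  have l0 : ygcd w = 0%R by rewrite /ygcd big_ord0.
  have zw : zero_one m.+1 w by exists 2; split=> //; constructor 3.
  rewrite -(eta_sol_null_abelian xfree mu_inv m0 n0 l0); exact: spec1.
(* The value 1 is attained by the empty word. *)
- pose w : word 0 := exist _ [::] isT.
  have n0 : nword w = 0%R by rewrite /nword /expsum big_nil oppr0.
  have zw : zero_one m.+1 w by exists 2; split=> //; constructor 1.
  rewrite -(@probability_setT _ _ _ mu) -(eta_sol_full G (w := w)).
    exact: spec1.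
  by rewrite n0 dvdz0.
Qed.
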